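(* Let $X$, $Y$, $\mathcal{S}$, $\mathcal{R}$, $\phi$ satisfy conditions (C1)–(C6) listed in the context, and let $\mathcal{T}_{\alpha,y}(x) = \mathcal{S}(x,y)+\alpha\mathcal{R}(x)$. Then for every $\alpha>0$ and every $y^\delta \in Y$ the set $\operatorname{crit}_{\alpha\phi}\mathcal{T}_{\alpha,y^\delta}$ of $\alpha\phi$-critical points of $\mathcal{T}_{\alpha,y^\delta}$ is non-empty.
   Context: Relative subgradients: for a Banach space $X$ with dual $X^*$, $F\colon X\to\mathbb{R}$ and $\psi\colon X\to[0,\infty)$, the set $\partial_\psi F(x)$ consists of all $r\in X^*$ with $F(x)+\langle r,u-x\rangle\le F(u)+\psi(u)$ for all $u\in X$. $F$ is relatively sub-differentiable with bound $\psi$ if $\partial_\psi F(x)\ne\emptyset$ for all $x\in X$. A point $x$ is a $\psi$-critical point of $F$ if $0\in\partial_\psi F(x)$; $\operatorname{crit}_\psi F$ denotes the set of all $\psi$-critical points of $F$. Setting: $\mathcal{S}\colon X\times Y\to[0,\infty)$, $\mathcal{R}\colon X\to[0,\infty)$, $\phi\colon X\to[0,\infty)$ and: (C1) $X$ is a reflexive Banach space and $Y$ is a metric space with metric $\mathcal{D}$. (C2) $\mathcal{R}$ is weakly sequentially lower semi-continuous. (C3) $\mathcal{R}$ is relatively sub-differentiable with bound $\phi$. (C4) $\mathcal{S}$ is weakly sequentially lower semi-continuous (i.e. $x_k\rightharpoonup x$ weakly in $X$ and $y_k\to y$ in $Y$ imply $\mathcal{S}(x,y)\le\liminf_k\mathcal{S}(x_k,y_k)$),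 convex in its first argument and continuous in its second argument. (C5) There exist $C>0$ and $p\ge1$ such that $\mathcal{S}(z,y)\le C\big(\mathcal{S}(z,y')+\mathcal{D}(y,y')^p\big)$ for all $z\in X$ and $y,y'\in Y$. (C6) For all $\alpha>0$ and $y\in Y$ the functional $\mathcal{T}_{\alpha,y}$ is coercive, i.e. $\mathcal{T}_{\alpha,y}(x)\to\infty$ as $\|x\|\to\infty$. *)

(* Defs.v *)
From HB Require Import structures.
From mathcomp Require Import all_boot all_order all_algebra.
From mathcomp Require Import all_classical all_reals all_analysis.

Set Implicit Arguments.
Unset Strict Implicit.
Unset Printing Implicit Defensive.

Import Order.TTheory GRing.Theory Num.Theory.
Import numFieldNormedType.Exports.

Local Open Scope classical_set_scope.
Local Open Scope ring_scope.

Definition linear_continuous_pred (R : realType) (X : normedModType R) :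
    {pred X -> R^o} :=
  fun f => `[< linear f /\ continuous f >].

(* The topological dual X^*, made a normed module by the operator norm below,
   so that dual (dual X) is the bidual. *)
Record dual (R : realType) (X : normedModType R) := Dual {
  dual_fun :> X -> R^o;
  dual_funP : dual_fun \in @linear_continuous_pred R X }.

Section dual_normedModType.
Variables (R : realType) (X : normedModType R).
Implicit Types f g : dual X.

HB.instance Definition _ := [isSub for @dual_fun R X].
HB.instance Definition _ := [Choice of dual X by <:].

Let linear_continuous_submod :
  GRing.submod_closed (@linear_continuous_pred R X).
Proof.
split=> [|a f g /asboolP[lf cf] /asboolP[lg cg]]; apply/asboolP; split.
- by move=> b x y; rewrite /= scaler0 addr0.
- by move=> x; exact: cst_continuous.
- move=> b x y; rewrite !fctE lf lg !scalerDr addrACA.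
  by rewrite !scalerA [a * b]mulrC.
- move=> x; rewrite !fctE.
  by apply: cvgD; [apply: cvgZl_tmp; exact: cf|exact: cg].
Qed.

HB.instance Definition _ :=
  GRing.isSubmodClosed.Build R (X -> R^o) (@linear_continuous_pred R X)
    linear_continuous_submod.
HB.instance Definition _ := [SubChoice_isSubLmodule of dual X by <:].

HB.instance Definition _ f :=
  GRing.isLinear.Build R X R^o *:%R f (asboolP _ (dual_funP f)).1.

Lemma dual_continuous f : continuous f.
Proof. exact: (asboolP _ (dual_funP f)).2. Qed.

Definition dual_norm f : R := sup [set `|f x| | x in [set x | `|x| <= 1]].

Lemma dual_norm_ubound f : has_ubound [set `|f x| | x in [set x | `|x| <= 1]].
Proof.
have /linear_bounded_continuous/bounded_funP/(_ 1)[M fM] := @dual_continuous f.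
by exists M => _ [x x1 <-]; exact: fM.
Qed.

Lemma dual_norm_le f x : `|f x| <= dual_norm f * `|x|.
Proof.
have [->|x0] := eqVneq x 0; first by rewrite linear0 !normr0 mulr0.
rewrite -ler_pdivrMr ?normr_gt0//; apply: ub_le_sup (dual_norm_ubound f) _ _.
exists (`|x|^-1 *: x); first by rewrite /= normrZ normfV normr_id mulVf ?normr_eq0.
by rewrite linearZ normrZ normfV normr_id mulrC.
Qed.

Lemma dual_normE_le f M : (forall x, `|x| <= 1 -> `|f x| <= M) -> dual_norm f <= M.
Proof.
move=> fM; apply: ge_sup; first by exists `|f 0|, 0 => //=; rewrite normr0.
by move=> _ [x x1 <-]; exact: fM.
Qed.

Lemma dual_norm_ge0 f : 0 <= dual_norm f.
Proof.
by apply: ub_le_sup (dual_norm_ubound f) _ _; exists 0; rewrite /= ?linear0 normr0.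
Qed.

Let dual_normD f g : dual_norm (f + g) <= dual_norm f + dual_norm g.
Proof.
apply: dual_normE_le => x x1; rewrite (le_trans (ler_normD _ _))// lerD//.
- by rewrite (le_trans (dual_norm_le _ _))// ler_piMr ?dual_norm_ge0.
- by rewrite (le_trans (dual_norm_le _ _))// ler_piMr ?dual_norm_ge0.
Qed.

Let dual_normZ_le (a : R) f : dual_norm (a *: f) <= `|a| * dual_norm f.
Proof.
apply: dual_normE_le => x x1; rewrite normrM ler_wpM2l//.
by rewrite (le_trans (dual_norm_le _ _))// ler_piMr ?dual_norm_ge0.
Qed.

Let dual_normZ (a : R) f : dual_norm (a *: f) = `|a| * dual_norm f.
Proof.
have [->|a0] := eqVneq a 0.
  apply/eqP; rewrite eq_le dual_normZ_le/= normr0 mul0r; exact: dual_norm_ge0.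
apply/eqP; rewrite eq_le dual_normZ_le/= -ler_pdivlMl ?normr_gt0//.
by rewrite -{1}[f](scalerK a0) -normfV dual_normZ_le.
Qed.

Let dual_norm0_eq0 f : dual_norm f = 0 -> f = 0.
Proof.
move=> f0; apply/val_inj/funext => x; apply/eqP; rewrite -normr_le0.
by rewrite (le_trans (dual_norm_le _ _))// f0 mul0r.
Qed.

HB.instance Definition _ := @Lmodule_isNormed.Build R (dual X)
  dual_norm dual_normD dual_normZ dual_norm0_eq0.

End dual_normedModType.

Section notions.
Variables (R : realType) (X : normedModType R).

(* The canonical embedding of X into its bidual, x |-> (r |-> r x), is onto. *)
Definition reflexive_space :=
  forall Phi : dual (dual X), exists x : X, forall r : dual X, Phi r = r x.

Definition weakly_cvg (u : X^nat) (x : X) :=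
  forall r : dual X, r (u k) @[k --> \oo] --> r x.

Definition weakly_seq_lsc (F : X -> R) := forall (u : X^nat) (x : X),
  weakly_cvg u x -> ((F x)%:E <= limn_einf (fun k => (F (u k))%:E))%E.

Definition weakly_seq_lsc2 (Y : topologicalType) (S : X -> Y -> R) :=
  forall (u : X^nat) (v : Y^nat) (x : X) (y : Y),
  weakly_cvg u x -> v @ \oo --> y ->
  ((S x y)%:E <= limn_einf (fun k => (S (u k) (v k))%:E))%E.

Definition relative_subdiff (psi F : X -> R) (x : X) : set (dual X) :=
  [set r : dual X | forall u, F x + r (u - x) <= F u + psi u].

Definition relatively_subdifferentiable (psi F : X -> R) :=
  forall x, relative_subdiff psi F x !=set0.

Definition crit (psi F : X -> R) : set X :=
  [set x | relative_subdiff psi F x 0].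

Definition coercive (F : X -> R) :=
  forall M : R, exists r : R, forall x, r < `|x| -> M < F x.

End notions.

Definition tikhonov (R : realType) (X Y : Type) (S : X -> Y -> R) (Reg : X -> R)
  (alpha : R) (y : Y) : X -> R := fun x => S x y + alpha * Reg x.

(* Main.v *)
(* No minimizer of T := S(., y) + alpha Reg is needed. Put J := T + alpha phi.
   The sublevel sets {J <= inf J + h} are bounded because T is coercive and
   phi >= 0, so by reflexivity they have a weak cluster point x as h -> 0.
   Convexity and lower semi-continuity of S(., y) give affine minorants that are
   e-exact at x; adding alpha times a phi-subgradient of Reg at x yields r in X^*
   with T x - e + r (u - x) <= J u for all u. Letting u run through the sublevel
   sets, T x <= inf J. *)

Require Import Defs.
From HB Require Import structures.
From mathcomp Require Import all_boot all_order all_algebra.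
From mathcomp Require Import all_classical all_reals all_analysis.
From mathcomp Require Import lra.

Set Implicit Arguments.
Unset Strict Implicit.
Unset Printing Implicit Defensive.

Import Order.TTheory GRing.Theory Num.Theory.
Import numFieldNormedType.Exports.

Local Open Scope classical_set_scope.
Local Open Scope ring_scope.

(** * Sublinear functionals and the Hahn-Banach theorem *)

Definition sublinear (R : realType) (V : lmodType R) (q : V -> R) :=
  (forall x y, q (x + y) <= q x + q y) /\
  (forall (t : R) x, 0 < t -> q (t *: x) <= t * q x).

(** The sublinear functionals built below are all pointwise infima; it is enough to find competitors
    at [x + y] and [t *: x] that do no worse. *)
Lemma inf_sublinear (R : realType) (V : lmodType R) (A : V -> set R) :
    (forall x, has_inf (A x)) ->
    (forall x y a b, A x a -> A y b -> exists2 c, A (x + y) c & c <= a + b) ->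
    (forall (t : R) x a, 0 < t -> A x a -> exists2 c, A (t *: x) c & c <= t * a) ->
  sublinear (fun x => inf (A x)).
Proof.
move=> Ainf AD AZ; split=> [x y|t x t0].
  rewrite /= -lerBlDr; apply: lb_le_inf; first exact: (Ainf x).1.
  move=> a Aa; rewrite lerBlDr -lerBlDl.
  apply: lb_le_inf; first exact: (Ainf y).1.
  move=> b Ab; rewrite lerBlDl.
  by have [c /(ge_inf (Ainf _).2) cA cab] := AD _ _ _ _ Aa Ab; exact: le_trans cab.
rewrite /= -ler_pdivrMl//; apply: lb_le_inf; first exact: (Ainf x).1.
move=> a /(AZ _ _ _ t0)[c /(ge_inf (Ainf _).2) cA cta].
by rewrite ler_pdivrMl//; exact: le_trans cta.
Qed.

Section sublinear_theory.
Variables (R : realType) (V : lmodType R).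
Implicit Types (p q : V -> R) (x v : V).

Lemma sublinear0 q : sublinear q -> q 0 = 0.
Proof.
(* Scaling [0] by 2 gives [0 <= q 0]; scaling it by 1/2 gives [q 0 <= 0]. *)
move=> [_ qZ]; have := qZ 2^-1 0; have := qZ 2 0.
rewrite !scaler0 invr_gt0 ltr0n => /(_ isT) q2 /(_ isT) q2V; lra.
Qed.

Lemma sublinearN_le q x : sublinear q -> - q (- x) <= q x.
Proof.
move=> sq; have := sq.1 x (- x); rewrite subrr sublinear0//; lra.
Qed.

Lemma sublinearZ q t x : sublinear q -> 0 <= t -> q (t *: x) = t * q x.
Proof.
move=> sq; rewrite le_eqVlt => /predU1P[<-|t0].
  by rewrite scale0r mul0r sublinear0.
apply/eqP; rewrite eq_le sq.2//= -ler_pdivlMl//.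
by rewrite -{1}[x](scalerK (lt0r_neq0 t0)) sq.2// invr_gt0.
Qed.

(* [x |-> inf_(t >= 0) (q (x + t v) - t q v)] is a sublinear minorant of [q],
   hence equal to [q] by minimality; the case [t = 1] gives the superadditivity
   of [q]. *)
Lemma minimal_sublinear_additive q : sublinear q ->
    (forall q', sublinear q' -> (forall x, q' x <= q x) -> q' = q) ->
  forall x v, q (x + v) = q x + q v.
Proof.
move=> sq qmin x v.
pose A x := [set q (x + t *: v) - t * q v | t in [set t | 0 <= t]].
have Ainf z : has_inf (A z).
  split; first by exists (q (z + 0 *: v) - 0 * q v), 0 => //=.
  (* [t q v = q (t v)] is at most [q (z + t v) + q (- z)]. *)
  exists (- q (- z)) => _ [t /= t0 <-].
  have := sq.1 (z + t *: v) (- z); rewrite addrAC subrr add0r sublinearZ//; lra.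
have sA : sublinear (fun z => inf (A z)).
  apply: inf_sublinear => // [y z _ _ [s /= s0 <-] [t /= t0 <-]|t z _ t0 [s /= s0 <-]].
    exists (q (y + z + (s + t) *: v) - (s + t) * q v).
      by exists (s + t) => //=; exact: addr_ge0.
    have := sq.1 (y + s *: v) (z + t *: v).
    rewrite addrACA -scalerDl; lra.
  exists (q (t *: z + (t * s) *: v) - t * s * q v).
    by exists (t * s) => //=; rewrite mulr_ge0// ltW.
  by rewrite -scalerA -scalerDr sublinearZ ?(ltW t0)// mulrBr mulrA.
apply/eqP; rewrite eq_le sq.1/= -lerBrDr.
rewrite -{1}(qmin _ sA); last first.
  move=> z; apply: ge_inf; first exact: (Ainf z).2.
  by exists 0 => //=; rewrite scale0r mul0r addr0 subr0.
apply: ge_inf; first exact: (Ainf x).2.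
by exists 1 => //=; rewrite scale1r mul1r.
Qed.

(** Zorn's lemma for the reversed pointwise order: a nonempty chain is bounded by its pointwise
    infimum, finite because [- p (- x) <= q x] for every sublinear [q <= p]. *)
Lemma exists_minimal_sublinear p : sublinear p -> exists q,
  [/\ sublinear q, forall x, q x <= p x &
      forall q', sublinear q' -> (forall x, q' x <= q x) -> q' = q].
Proof.
move=> sp.
pose T := {q : V -> R | sublinear q /\ forall x, q x <= p x}.
pose mkT q sq qp : T :=
  exist (fun q => sublinear q /\ forall x, q x <= p x) q (conj sq qp).
pose ord (q1 q2 : T) := `[< forall x, sval q2 x <= sval q1 x >].
have ordP (q1 q2 : T) : reflect (forall x, sval q2 x <= sval q1 x) (ord q1 q2).
  exact: asboolP.
have valTI (q1 q2 : T) : sval q1 = sval q2 -> q1 = q2.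
  case: q1 q2 => [q1 h1] [q2 h2] /= q12; subst q2.
  by congr exist; exact: Prop_irrelevance.
have [//|r s t|r s|C Ctot|[q [sq qp]] qmax] := @Zorn T ord.
- by move=> q; apply/ordP.
- move=> /ordP rs /ordP st; apply/ordP => x; exact: le_trans (st x) (rs x).
- move=> /ordP rs /ordP sr; apply/valTI/funext => x.
  by apply/eqP; rewrite eq_le rs sr.
- have [[q0 Cq0]|C0] := pselect (C !=set0); last first.
    exists (mkT p sp (fun x => lexx _)) => q Cq.
    by case: C0; exists q.
  pose A x := [set sval q x | q in C].
  have Ainf x : has_inf (A x).
    split; first by exists (sval q0 x), q0.
    exists (- p (- x)) => _ [q Cq <-]; have [sq qp] := svalP q.
    by rewrite (le_trans _ (sublinearN_le _ sq))// lerN2.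
  have sA : sublinear (fun x => inf (A x)).
    apply: inf_sublinear => // [x y _ _ [q1 Cq1 <-] [q2 Cq2 <-]|t x _ t0 [q Cq <-]].
      (* The smaller of the two members of the chain is the competitor at [x + y]. *)
      have [/ordP q12|/ordP q21] := Ctot _ _ Cq1 Cq2.
        exists (sval q2 (x + y)); first by exists q2.
        by rewrite (le_trans ((svalP q2).1.1 _ _))// lerD.
      exists (sval q1 (x + y)); first by exists q1.
      by rewrite (le_trans ((svalP q1).1.1 _ _))// lerD.
    exists (sval q (t *: x)); first by exists q.
    by rewrite (svalP q).1.2.
  have Ap x : inf (A x) <= p x.
    rewrite (le_trans _ ((svalP q0).2 x))//; apply: ge_inf; first exact: (Ainf x).2.
    by exists q0.
  exists (mkT _ sA Ap) => q Cq; apply/ordP => x /=.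
  by apply: ge_inf; [exact: (Ainf x).2|exists q].
exists q; split=> // q' sq' q'q.
have q'p x : q' x <= p x by exact: le_trans (q'q x) (qp x).
by have /(congr1 sval) := qmax (mkT _ sq' q'p)
  (introT (ordP (mkT _ sq qp) (mkT _ sq' q'p)) q'q).
Qed.

(** A minimal sublinear functional below [p] is additive, hence odd, hence homogeneous for every
    real scalar. *)
Lemma hahn_banach p : sublinear p ->
  exists2 f : V -> R^o, linear f & forall x, f x <= p x.
Proof.
move=> /exists_minimal_sublinear[q [sq qp qmin]]; exists q => //.
have qD := minimal_sublinear_additive sq qmin.
have qN x : q (- x) = - q x.
  by apply/eqP; rewrite -addr_eq0 -qD addNr sublinear0.
move=> a x y; rewrite qD; congr (_ + _).
have [a0|/ltW a0] := leP 0 a; first by rewrite sublinearZ.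
by rewrite -[a in LHS]opprK scaleNr qN sublinearZ ?oppr_ge0// mulNr opprK.
Qed.

End sublinear_theory.

(** The one-sided bound suffices: at [- x] it gives the other side. *)
Lemma dual_of_linear_le (R : realType) (X : normedModType R) (f : X -> R^o) (K : R) :
    linear f -> (forall x, f x <= K * `|x|) ->
  exists r : dual X, forall x, r x = f x.
Proof.
move=> lf fK.
pose F : {linear X -> R^o} := HB.pack f (GRing.isLinear.Build R X R^o *:%R f lf).
have cf : continuous F.
  apply: bounded_linear_continuous; apply/linear_boundedP.
  near=> M => x; apply: (@le_trans _ _ (K * `|x|)); last first.
    by rewrite ler_wpM2r//; near: M; exact: nbhs_pinfty_ge.
  rewrite ler_norml fK andbT lerNl -(linearN F) -(normrN x).
  exact: fK.
by exists (Dual (introT (asboolP _) (conj lf cf))).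
Unshelve. all: by end_near. Qed.

(** * Affine minorants of convex functions *)

Section affine_minorant.
Variables (R : realType) (X : normedModType R) (F : X -> R).
Hypothesis cF : convex_function [set: X] F.

Lemma convex_function_le (s t : R) x y : 0 <= s -> 0 <= t -> s + t = 1 ->
  F (s *: x + t *: y) <= s * F x + t * F y.
Proof.
move=> s0 t0 st1; have s1 : s <= 1 by lra.
have -> : t = 1 - s by lra.
exact: (cF (Itv01 s0 s1) (mem_set I : x \in [set: X])
  (mem_set I : y \in [set: X])).
Qed.

(** Subadditivity of the perspective [(l, v) |-> l F (x + v / l)]: the left point is the convex
    combination of the right ones with weights [s / (s + t)] and [t / (s + t)]. *)
Lemma convex_perspective_le (s t : R) x v w : 0 < s -> 0 < t ->
  (s + t) * F (x + (s + t)^-1 *: (v + w)) <=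
  s * F (x + s^-1 *: v) + t * F (x + t^-1 *: w).
Proof.
move=> s0 t0; have st0 : 0 < s + t by exact: addr_gt0.
have -> : x + (s + t)^-1 *: (v + w) =
    (s / (s + t)) *: (x + s^-1 *: v) + (t / (s + t)) *: (x + t^-1 *: w).
  rewrite !scalerDr addrACA -scalerDl -mulrDl divff ?lt0r_neq0// scale1r.
  rewrite !scalerA (mulrAC s) (mulrAC t) !divff ?lt0r_neq0//.
  by rewrite !mul1r.
rewrite (le_trans (ler_wpM2l (ltW st0) (convex_function_le _ _ _ _ _)))//.
- by rewrite divr_ge0// ltW.
- by rewrite divr_ge0// ltW.
- by rewrite -mulrDl divff ?lt0r_neq0.
- have stK z : (s + t) * (z / (s + t)) = z by rewrite mulrCA divff ?mulr1 ?lt0r_neq0.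
  by rewrite mulrDr !(mulrA (s + t) (_ / _)) !stK.
Qed.

(* [inf_(l > 0, w) (l (F (x + w / l) - F x + e) + K |v - w|)], the greatest
   sublinear minorant of [v |-> F (x + v) - F x + e] and [v |-> K |v|], is
   finite for [K := F x / d]. *)
Lemma convex_affine_minorant x e : (forall u, 0 <= F u) ->
    (exists2 d, 0 < d & forall w, `|w| <= d -> F x - e <= F (x + w)) ->
  exists r : dual X, forall u, F x - e + r (u - x) <= F u.
Proof.
move=> F0 [d d0 Fd]; set a := F x - e; pose K := F x / d.
have e0 : 0 <= e.
  by have := Fd 0; rewrite normr0 addr0 ltW// => /(_ isT); rewrite lerBlDr lerDl.
have K0 : 0 <= K by rewrite divr_ge0// ltW.
(* Within distance [d] this is [Fd]; beyond it, [K |w| >= F x >= a] and [F >= 0]. *)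
have FK w : 0 <= F (x + w) - a + K * `|w|.
  have [/Fd aF|/ltW dw] := leP `|w| d; first by rewrite addr_ge0 ?subr_ge0// mulr_ge0.
  have : F x <= K * `|w| by rewrite -(divfK (lt0r_neq0 d0) (F x)) ler_wpM2l.
  have := F0 (x + w); rewrite /a; lra.
pose g v (lw : R * X) := lw.1 * (F (x + lw.1^-1 *: lw.2) - a) + K * `|v - lw.2|.
pose A v := [set g v lw | lw in [set lw | 0 < lw.1]].
(* Scale [FK] at [w / l] by [l], then use [K |w| <= K |v| + K |v - w|]. *)
have Alb v : lbound (A v) (- (K * `|v|)).
  move=> _ [[l w] /= l0 <-]; rewrite /g /=.
  have : 0 <= l * (F (x + l^-1 *: w) - a) + K * `|w|.
    have := mulr_ge0 (ltW l0) (FK (l^-1 *: w)).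
    rewrite mulrDr normrZ gtr0_norm ?invr_gt0// mulrCA.
    by rewrite (mulrA l) divff ?lt0r_neq0// mul1r.
  have : K * `|w| <= K * `|v| + K * `|v - w|.
    rewrite -mulrDr ler_wpM2l//.
    by rewrite -{1}(subKr v w) ler_normB.
  lra.
have Ainf v : has_inf (A v).
  by split; [exists (g v (1, 0)), (1, 0) => //=; exact: ltr01|exists (- (K * `|v|))].
have sA : sublinear (fun v => inf (A v)).
  apply: inf_sublinear => //.
    move=> v1 v2 _ _ [[l1 w1] /= l1_0 <-] [[l2 w2] /= l2_0 <-].
    exists (g (v1 + v2) (l1 + l2, w1 + w2)).
      by exists (l1 + l2, w1 + w2) => //=; exact: addr_gt0.
    rewrite /g /=; have := convex_perspective_le x w1 w2 l1_0 l2_0.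
    have : K * `|v1 + v2 - (w1 + w2)| <= K * `|v1 - w1| + K * `|v2 - w2|.
      by rewrite -mulrDr ler_wpM2l// opprD addrACA ler_normD.
    lra.
  move=> t v _ t0 [[l w] /= l0 <-].
  exists (g (t *: v) (t * l, t *: w)).
    by exists (t * l, t *: w) => //=; exact: mulr_gt0.
  have -> : g (t *: v) (t * l, t *: w) = t * g v (l, w); last by [].
  have tl : (t * l)^-1 * t = l^-1 by rewrite invfM mulrAC mulVf ?mul1r ?lt0r_neq0.
  rewrite /g /= scalerA tl.
  rewrite -scalerBr normrZ gtr0_norm//; lra.
have [f lf fA] := hahn_banach sA.
have fK v : f v <= K * `|v|.
  apply/ler_addgt0Pr => h h0; apply: (le_trans (fA v)).
  (* At [w = 0] the infimand is [l e + K |v|], and this [l] gives [l e <= h]; the [+ 1] covers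
     [e = 0]. *)
  pose l := h / (e + 1).
  have l0 : 0 < l by rewrite divr_gt0// ltr_wpDl.
  apply: (@le_trans _ _ (g v (l, 0))).
    by apply: ge_inf; [exact: (Ainf v).2|exists (l, 0)].
  rewrite /g /= scaler0 addr0 subr0 addrC lerD2l /a subKr.
  by rewrite /l mulrAC ler_pdivrMr ?ltr_wpDl// ler_wpM2l ?(ltW h0)// lerDl.
have [r rf] := dual_of_linear_le lf fK; exists r => u.
rewrite rf -lerBrDl (le_trans (fA _))//.
apply: ge_inf; first exact: (Ainf _).2.
(* This pair kills the norm term and leaves [F u - a]. *)
exists (1, u - x) => //=.
by rewrite /g /= invr1 scale1r mul1r subrr normr0 mulr0 addr0 (addrC x) subrK.
Qed.

End affine_minorant.

(** * Weak cluster points and weak lower semi-continuity *)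

(* Hahn-Banach applied on the dual to the upper limit of [r] along [G]. *)
Lemma reflexive_weak_cluster (R : realType) (X : normedModType R)
    (G : set_system X) (M : R) : ProperFilter G -> reflexive_space X ->
    (\forall u \near G, `|u| <= M) ->
  exists x : X, forall (r : dual X) (b : R), (\forall u \near G, r u <= b) -> r x <= b.
Proof.
move=> GG rX GM.
pose A (r : dual X) := [set b | \forall u \near G, r u <= b].
have rM (r : dual X) u : `|u| <= M -> `|r u| <= M * `|r|.
  move=> uM; rewrite (le_trans (dual_norm_le r u))// mulrC.
  exact: ler_wpM2r (normr_ge0 r) _ _ uM.
have Ainf r : has_inf (A r).
  split.
    exists (M * `|r|); apply: filterS GM => u /(rM r).
    by rewrite ler_norml => /andP[].
  exists (- (M * `|r|)) => b Ab.
  (* Properness of [G] makes both eventual bounds hold at a common point. *)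
  have /filter_ex[u [ub /(rM r)]] : \forall u \near G, r u <= b /\ `|u| <= M.
    by apply: filterS2 Ab GM => u.
  by rewrite ler_norml => /andP[+ _]; move=> /le_trans; exact.
have sA : sublinear (fun r => inf (A r)).
  apply: inf_sublinear => // [r s a b Aa Ab|t r a t0 Aa].
    exists (a + b) => //; apply: filterS2 Aa Ab => u ra sb.
    exact: lerD.
  exists (t * a) => //; apply: filterS Aa => u ra.
  by rewrite ler_wpM2l// ltW.
have [f lf fA] := hahn_banach sA.
have fM r : f r <= M * `|r|.
  rewrite (le_trans (fA r))//; apply: ge_inf; first exact: (Ainf r).2.
  by apply: filterS GM => u /(rM r); rewrite ler_norml => /andP[].
(* Being bounded, [f] lies in the bidual, and reflexivity represents it by a point [x]. *)
have [Phi Phif] := dual_of_linear_le lf fM; have [x Phix] := rX Phi.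
exists x => r b Ab; rewrite -Phix Phif (le_trans (fA r))//.
by apply: ge_inf; first exact: (Ainf r).2.
Qed.

(** Norm convergence implies weak convergence, so points violating the bound at radii [1 / (n + 1)]
    contradict weak lower semi-continuity. *)
Lemma weakly_seq_lsc_norm_lsc (R : realType) (X : normedModType R) (F : X -> R) x e :
    weakly_seq_lsc F -> 0 < e ->
  exists2 d, 0 < d & forall w, `|w| <= d -> F x - e <= F (x + w).
Proof.
move=> lscF e0; apply: contrapT => noF.
have /choice[w wF] : forall n : nat,
    exists w : X, `|w| <= n.+1%:R^-1 /\ F (x + w) < F x - e.
  move=> n; apply: contrapT => now; apply: noF; exists n.+1%:R^-1 => // w wn.
  by rewrite leNgt; apply/negP => wF; apply: now; exists w.
have w0 : w n @[n --> \oo] --> 0.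
  apply/cvgr0Pnorm_le => h h0; near=> n.
  rewrite (le_trans (wF n).1)//; apply: ltW; near: n.
  exact: near_infty_natSinv_lt (PosNum h0).
have xw : weakly_cvg (fun n => x + w n) x.
  move=> r; apply: (@cvg_comp _ _ _ (fun n => x + w n) r _ (nbhs x)).
    by have := cvgD (cvg_cst x) w0; rewrite addr0; exact.
  exact: dual_continuous.
have := lscF _ _ xw; apply/negP; rewrite -ltNge.
apply: (@le_lt_trans _ _ (F x - e)%:E); last by rewrite lte_fin gtrBl.
rewrite limn_einf_lim; apply: lime_le; first exact: is_cvg_einfs.
(* Each tail infimum is at most its first term. *)
apply: nearW => n; apply: ge_ereal_inf.
by exists (F (x + w n))%:E; [exists n => //=|rewrite lee_fin ltW// (wF n).2].
Unshelve. all: by end_near. Qed.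

(** * Critical points of the Tikhonov functional *)

Theorem theorem3p2 (R : realType) (X : completeNormedModType R)
    (Y : metricType R) (S : X -> Y -> R) (Reg phi : X -> R)
    (S_ge0 : forall x y, 0 <= S x y)
    (Reg_ge0 : forall x, 0 <= Reg x)
    (phi_ge0 : forall x, 0 <= phi x)
    (C1 : reflexive_space X)
    (C2 : weakly_seq_lsc Reg)
    (C3 : relatively_subdifferentiable phi Reg)
    (C4_lsc : weakly_seq_lsc2 S)
    (C4_convex : forall y, convex_function [set: X] (fun x => S x y))
    (C4_continuous : forall x, continuous (S x))
    (C5 : exists C p : R, [/\ 0 < C, 1 <= p &
      forall (z : X) (y y' : Y), S z y <= C * (S z y' + mdist y y' `^ p)])
    (C6 : forall (alpha : R) (y : Y), 0 < alpha ->
      coercive (tikhonov S Reg alpha y)) :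
  forall (alpha : R) (ydelta : Y), 0 < alpha ->
    crit (fun x => alpha * phi x) (tikhonov S Reg alpha ydelta) !=set0.
Proof.
move=> alpha y alpha0.
set T := tikhonov S Reg alpha y; pose J u := T u + alpha * phi u.
have J0 u : 0 <= J u by rewrite !addr_ge0 ?mulr_ge0// ltW.
have Jinf : has_inf (range J).
  by split; [exists (J 0), 0|exists 0 => _ [u _ <-]].
pose m := inf (range J).
pose G : set_system X :=
  filter_from [set h | 0 < h] (fun h => [set u | J u <= m + h]).
have GG : ProperFilter G.
  apply: filter_from_proper; first apply: filter_from_filter.
  - by exists 1 => /=.
  - move=> h k /= h0 k0; exists (Num.min h k); first by rewrite lt_min h0.
    by move=> u /= uhk; split; rewrite (le_trans uhk)// lerD2l ge_min lexx ?orbT.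
  - move=> h h0; have [_ [u _ <-] /ltW uh] := inf_adherent h0 Jinf.
    by exists u.
(* Since [T <= J], coercivity at level [m + 1] bounds the sublevel set with [h = 1]. *)
have [M TM] := C6 alpha y alpha0 (m + 1).
have GM : \forall u \near G, `|u| <= M.
  exists 1 => //= u uJ; rewrite leNgt; apply/negP => /TM; apply/negP.
  by rewrite -leNgt (le_trans _ uJ)// lerDl mulr_ge0// ltW.
have [x xG] := reflexive_weak_cluster GG C1 GM.
exists x => u /=; rewrite addr0.
(* Criticality of [x] reads [T x <= J u] for all [u]. *)
suff Tm : T x <= m.
  by rewrite (le_trans Tm)//; apply: ge_inf; [exact: Jinf.2|exists u].
(* One half of [e] pays for the affine minorant of [S], the other for the height of the sublevel
   set. *)
apply/ler_addgt0Pr => e e0; have e20 : 0 < e / 2 by rewrite divr_gt0.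
have lscS : weakly_seq_lsc (S^~ y).
  by move=> w z wz; apply: C4_lsc => //; exact: cvg_cst.
have [r1 r1S] := convex_affine_minorant (C4_convex y) (S_ge0^~ y)
  (weakly_seq_lsc_norm_lsc x lscS e20).
have [r2 r2Reg] := C3 x.
(* With [r = r1 + alpha r2], the bound is [m + e + r x - T x], so that passing it to [x] gives
   [T x <= m + e]. *)
have := xG (r1 + alpha *: r2) (m + e + (r1 x + alpha * r2 x) - T x).
have -> : (r1 + alpha *: r2) x = r1 x + alpha * r2 x by [].
suff Gr : \forall u \near G,
    (r1 + alpha *: r2) u <= m + e + (r1 x + alpha * r2 x) - T x.
  move=> /(_ Gr); lra.
exists (e / 2) => // {}u uJ.
have -> : (r1 + alpha *: r2) u = r1 u + alpha * r2 u by [].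
have := r1S u; rewrite linearB /=.
have := ler_wpM2l (ltW alpha0) (r2Reg u); rewrite linearB /=.
move: uJ; rewrite /= /J /T /tikhonov; lra.
Qed.
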